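(* For a positive integer $n$ whose decimal expansion does not end in $0$ or $5$, let $\tau(n)$ be the least number of Choix de Bruxelles operations needed to transform $1$ into $n$. Then there exists $N$ such that for all $n \ge N$ whose decimal expansion does not end in $0$ or $5$, $$\log_{10} n + 5 < \tau(n) \le 12 \log_{10} n.$$
   Context: The Choix de Bruxelles operation: given a positive integer $n$ with decimal expansion $d_1 d_2 \ldots d_k$, choose indices $1 \le p \le q \le k$ with $d_p \neq 0$, let $s$ be the number with decimal representation $d_p d_{p+1}\ldots d_q$, and replace this substring in situ by the decimal expansion of $2s$, or, if $s$ is even, by the decimal expansion of $s/2$. One may also leave $n$ unchanged (empty substring). Every positive integer not ending in $0$ or $5$ can be reached from $1$ by finitely many such operations, so $\tau(n)$ is well defined. *)

(* Defs.v *)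
From mathcomp Require Import all_boot all_order all_algebra.
From mathcomp Require Import classical_sets reals exp.

Set Implicit Arguments.
Unset Strict Implicit.
Unset Printing Implicit Defensive.

(* Most significant digit first; [digits 0 = [:: 0]]. *)
Definition digits (n : nat) : seq nat :=
  [seq n %/ 10 ^ i %% 10 | i <- rev (iota 0 (trunc_log 10 n).+1)].

Definition value (ds : seq nat) : nat := foldl (fun v d => v * 10 + d) 0 ds.

(* The chosen substring d_p ... d_q is [s]; [head 0 s != 0] says both that it
   is nonempty and that d_p is nonzero. *)
Inductive choix (n : nat) : nat -> Prop :=
| choix_id : choix n n
| choix_double (u s v : seq nat) :
    digits n = u ++ s ++ v -> head 0 s != 0 ->
    choix n (value (u ++ digits (2 * value s) ++ v))
| choix_halve (u s v : seq nat) :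
    digits n = u ++ s ++ v -> head 0 s != 0 -> 2 %| value s ->
    choix n (value (u ++ digits (value s %/ 2) ++ v)).

Definition reaches_in (t m n : nat) : Prop :=
  exists c : nat -> nat,
    [/\ c 0 = m, c t = n & forall i, i < t -> choix (c i) (c i.+1)].

Definition least_ops (n t : nat) : Prop :=
  reaches_in t 1 n /\ forall t', reaches_in t' 1 n -> t <= t'.

(* The default 0 is returned when [n] is not reachable from 1. *)
Definition tau (n : nat) : nat := xget 0 [set t | least_ops n t]%classic.

Definition log10 (R : realType) (x : R) : R := (ln x / ln 10)%R.

(* Main.v *)
(** Let [n] have [k + 1] digits, so that [k <= log10 n < k + 1].

    Upper bound.  Every two-digit string [ab] is obtained in at most 12
    operations from [5] if [b] is 0 or 5, and from [1] otherwise.  Starting from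
    [1], unfold the leading digit into two digits [s b], where [b] is the last
    digit of [n] and [s] is 1 or 5 according to the preceding digit of [n], and
    go on with [s]; after [k] such stages the string is [n].

    Lower bound.  An operation lengthens the string by at most one digit, so
    reaching [n] takes at least [k] operations, and more if some of them do not
    lengthen it.  Only finitely many strings, all of at most five digits, arise
    from [1] with an excess of at most 5 over this bound. *)

Require Import Defs.
From mathcomp Require Import all_boot all_order all_algebra.
From mathcomp Require Import reals.
From mathcomp Require Import boolp classical_sets exp.
From mathcomp Require Import zify.

Set Implicit Arguments.
Unset Strict Implicit.
Unset Printing Implicit Defensive.

(** * Decimal strings and their values *)

(** The default of [head] excludes the empty string, so [value] and [digits] are mutually inverse
    between these strings and the positive integers. *)
Definition numeral (s : seq nat) := all (gtn 10) s && (head 0 s != 0).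

Lemma value_rcons s d : value (rcons s d) = value s * 10 + d.
Proof. by rewrite /value foldl_rcons. Qed.

Lemma value_cat s t : value (s ++ t) = value s * 10 ^ size t + value t.
Proof.
elim/last_ind: t => [|t d IH]; first by rewrite cats0 muln1 addn0.
rewrite -rcons_cat !value_rcons IH size_rcons expnSr; lia.
Qed.

Lemma value_cons d s : value (d :: s) = d * 10 ^ size s + value s.
Proof. by rewrite -cat1s value_cat. Qed.

Lemma numeral_value_gt0 s : numeral s -> 0 < value s.
Proof.
case: s => //= d s; rewrite /numeral /= => /andP[_ d0].
rewrite value_cons ltn_addr // muln_gt0 expn_gt0 /=; lia.
Qed.

Lemma digits_lt10 n : n < 10 -> digits n = [:: n].
Proof.
move=> n10; rewrite /digits (_ : trunc_log 10 n = 0) /=.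
  by rewrite divn1 modn_small.
by case: n n10 => // n n10; apply: trunc_log_eq.
Qed.

(** Turns the positional formula into a recursion on the last digit, through which the inductions
    below go. *)
Lemma digits_rec n d : 0 < n -> d < 10 -> digits (n * 10 + d) = rcons (digits n) d.
Proof.
move=> n0 d10; have tl : trunc_log 10 (n * 10 + d) = (trunc_log 10 n).+1.
  apply: trunc_log_eq => //; have /andP[lo hi] := trunc_log_bounds (isT : 1 < 10) n0.
  rewrite !expnS in hi *; apply/andP; split; lia.
rewrite /digits tl -[iota 0 _.+2]/(0 :: iota (1 + 0) _.+1) iotaDl rev_cons map_rcons.
rewrite -map_rev -map_comp; congr rcons; last by rewrite /= divn1 modnMDl modn_small.
apply: eq_map => i /=; rewrite expnD expn1 divnMA; congr (_ %/ _ %% _).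
by rewrite divnMDl // divn_small // addn0.
Qed.

Lemma value_digits n : value (digits n) = n.
Proof.
elim/ltn_ind: n => n IH; case: (ltnP n 10) => n10; first by rewrite digits_lt10.
rewrite {1}(divn_eq n 10) digits_rec ?value_rcons ?IH -?divn_eq //; lia.
Qed.

Lemma numeral_rcons s d : numeral s -> d < 10 -> numeral (rcons s d).
Proof. by rewrite /numeral all_rcons; case: s => //= e s /andP[-> ->] ->. Qed.

Lemma numeral_cat s t : numeral s -> all (gtn 10) t -> numeral (s ++ t).
Proof. by rewrite /numeral all_cat; case: s => //= e s /andP[-> ->] ->. Qed.

Lemma numeral_digits n : 0 < n -> numeral (digits n).
Proof.
elim/ltn_ind: n => n IH n0; case: (ltnP n 10) => n10.
  by rewrite digits_lt10 // /numeral /= n10 andbT -lt0n.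
rewrite (divn_eq n 10) digits_rec ?numeral_rcons ?IH ?ltn_pmod //; lia.
Qed.

Lemma digits_value s : numeral s -> digits (value s) = s.
Proof.
elim/last_ind: s => // s d IH ns; have d10 : d < 10.
  by move: ns; rewrite /numeral all_rcons => /andP[/andP[]].
rewrite value_rcons; have [s0|s0] := eqVneq s [::].
  by rewrite s0 /= digits_lt10.
have nss : numeral s.
  by move: ns s0; rewrite /numeral all_rcons; case: (s) => //= e t /andP[/andP[_ ->] ->].
by rewrite digits_rec ?IH ?numeral_value_gt0.
Qed.

Lemma size_digits n : size (digits n) = (trunc_log 10 n).+1.
Proof. by rewrite size_map size_rev size_iota. Qed.

(** * Doubling and halving digit by digit *)

(** Schoolbook doubling from the right: outgoing carry, then as many digits as the input. Working
    digitwise keeps the numbers small when neighbours are enumerated by computation. *)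
Fixpoint double_carry (s : seq nat) : nat * seq nat :=
  if s is d :: s' then
    let: (c, t) := double_carry s' in
    let e := d + d + c in
    if 10 <= e then (1, (e - 10) :: t) else (0, e :: t)
  else (0, [::]).

Definition double (s : seq nat) : seq nat :=
  let: (c, t) := double_carry s in if c is 0 then t else c :: t.

Lemma double_carryP s : all (gtn 10) s ->
  let: (c, t) := double_carry s in
  [/\ c <= 1, size t = size s, all (gtn 10) t
    & c * 10 ^ size s + value t = 2 * value s].
Proof.
elim: s => //= d s IH /andP[d10 /IH]; case: (double_carry s) => c t [c1 st t10 vt].
have {}d10 : d < 10 by [].
case: ifPn => e10; rewrite /= ?st t10 ?andbT.
  split=> //=; first lia.
  rewrite !value_cons st expnS; move: (10 ^ _) vt => k; nia.
split=> //=; first lia.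
rewrite !value_cons st expnS; move: (10 ^ _) vt => k; nia.
Qed.

Lemma digits_double s : numeral s -> digits (2 * value s) = double s.
Proof.
move=> ns; have := ns => /andP[s10 h0]; have := double_carryP s10; rewrite /double.
case E : (double_carry s) => [c t] [c1 st t10 vt].
case: c c1 E vt => [|[]] // _ E vt; last first.
  by rewrite -vt -st -value_cons digits_value // /numeral /= t10.
rewrite -vt mul0n digits_value // /numeral t10 /=.
(* Without an outgoing carry, the leading digit is [d + d] plus a carry, nonzero since [d] is. *)
case: s E h0 {ns s10 st vt} => //= d s; case: (double_carry s) => c u.
by case: ifP => // _ [<-] /=; lia.
Qed.

Lemma size_double s : numeral s -> size (double s) <= (size s).+1.
Proof.
move=> /andP[s10 _]; have := double_carryP s10; rewrite /double.
by case: (double_carry s) => -[|c] t [_ <- _ _] /=.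
Qed.

(** Long division by 2 from the left; the remainder [r] of the preceding digit adds 5 to the
    quotient digit. *)
Fixpoint halve_carry (r : bool) (s : seq nat) : seq nat :=
  if s is d :: s' then (r * 5 + d./2) :: halve_carry (odd d) s' else [::].

Definition halve (s : seq nat) : seq nat :=
  let t := halve_carry false s in if head 0 t is 0 then behead t else t.

Lemma size_halve_carry r s : size (halve_carry r s) = size s.
Proof. by elim: s r => //= d s IH r; rewrite IH. Qed.

Lemma halve_carry_digits r s : all (gtn 10) s -> all (gtn 10) (halve_carry r s).
Proof.
elim: s r => //= d s IH r /andP[d10 /IH->]; rewrite andbT.
have {}d10 : d < 10 by []. have := half_leq (d10 : d <= 9); case: r => /=; lia.
Qed.

Lemma value_halve_carry r s :
  value (halve_carry r s) = (r * 10 ^ size s + value s) %/ 2.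
Proof.
elim: s r => [|d s IH] r; first by case: r.
rewrite /= !value_cons IH size_halve_carry expnS.
move: (10 ^ size s) => k.
have -> : r * (10 * k) + (d * k + value s)
    = (r * 5 + d./2) * k * 2 + (odd d * k + value s).
  by rewrite -{1}(odd_double_half d) -muln2; lia.
by rewrite divnMDl.
Qed.

Lemma digits_halve s : numeral s -> 2 %| value s ->
  digits (value s %/ 2) = halve s.
Proof.
move=> ns s2; have := numeral_value_gt0 ns; have := ns => /andP[s10 _] s0.
have vh := value_halve_carry false s; rewrite mul0n add0n in vh.
have h0 : 0 < value (halve_carry false s) by rewrite vh; lia.
rewrite -vh /halve; have := halve_carry_digits false s10.
case: s ns s2 s10 s0 vh h0 => //= d s ns s2 /andP[d10 s10] s0 vh h0.
case E : d./2 => [|e] /= hd; last by rewrite digits_value // /numeral /= hd.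
rewrite value_cons mul0n add0n digits_value // /numeral hd /=.
move: (ns); rewrite /numeral /= => /andP[_ d0].
(* A leading quotient digit 0 forces [d = 1]. The value being even, another digit follows, and its
   quotient digit is at least 5, so only one zero has to be dropped. *)
have d1 : d = 1 by lia.
move: h0 s2 s0; rewrite d1 !value_cons /= => _.
case: s {E ns hd vh s10} => //= e s; lia.
Qed.

Lemma size_halve s : size (halve s) <= size s.
Proof.
rewrite -(size_halve_carry false s) /halve.
by case: (halve_carry false s) => //= -[|e] t //=; exact: leqnSn.
Qed.

(** * Neighbours of a digit string *)

Definition ops (s : seq nat) : seq (seq nat) :=
  double s :: if odd (last 0 s) then [::] else [:: halve s].

Definition prefix_ops (x : seq nat) : seq (seq nat) :=
  [seq t ++ drop i x | i <- iota 1 (size x), t <- ops (take i x)].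

(** The chosen substring either starts at the head, which must then be nonzero, or lies in the
    tail. *)
Fixpoint nbrs (x : seq nat) : seq (seq nat) :=
  if x is d :: x' then
    (if d == 0 then [::] else prefix_ops x) ++ [seq d :: y | y <- nbrs x']
  else [::].

Lemma nbrsP (x y : seq nat) :
  reflect (exists u s v t : seq nat,
    [/\ x = u ++ s ++ v, head 0 s != 0, t \in ops s & y = u ++ t ++ v])
   (y \in nbrs x).
Proof.
apply: (iffP idP).
  elim: x y => //= d x IH y; rewrite mem_cat => /orP[|/mapP[z /IH]].
    case: ifPn => // d0 /allpairsPdep[i [t []]].
    rewrite mem_iota => /andP[i0 _] ti ->.
    exists [::], (take i (d :: x)), (drop i (d :: x)), t.
    by rewrite cat_take_drop ti; split=> //; case: (i) i0.
  by move=> [u [s [v [t [-> s0 ts ->]]]]] ->; exists (d :: u), s, v, t.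
case=> u [s [v [t [-> s0 ts ->]]]] {x y}; elim: u => [|d u IH] /=; last first.
  by rewrite mem_cat map_f ?orbT.
case: s s0 ts => //= d s d0 ts; rewrite (negPf d0) mem_cat; apply/orP; left.
apply/allpairsPdep; exists (size (d :: s)), t.
rewrite -cat_cons mem_iota take_size_cat // drop_size_cat // size_cat /=.
by split=> //; lia.
Qed.

(** Lets operations found on short strings act in front of an arbitrary fixed tail. *)
Lemma nbrs_catr (x y v : seq nat) : y \in nbrs x -> y ++ v \in nbrs (x ++ v).
Proof.
case/nbrsP=> u [s [w [t [-> s0 ts ->]]]]; apply/nbrsP.
by exists u, s, (w ++ v), t; rewrite -!catA.
Qed.

Lemma odd_value s : odd (value s) = odd (last 0 s).
Proof.
by elim/last_ind: s => // s d _; rewrite value_rcons last_rcons oddD oddM andbF.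
Qed.

Lemma opsP (s t : seq nat) : numeral s ->
  reflect (t = digits (2 * value s)
           \/ 2 %| value s /\ t = digits (value s %/ 2)) (t \in ops s).
Proof.
move=> ns; rewrite inE digits_double // dvdn2 odd_value.
case: ifPn => os; rewrite ?inE ?orbF; apply: (iffP idP).
- by move/eqP; left.
- by case=> [->|[]].
- case/orP=> /eqP->; first by left.
  by right; rewrite digits_halve ?dvdn2 ?odd_value.
- by case=> [->|[_ ->]]; rewrite ?digits_halve ?dvdn2 ?odd_value // eqxx ?orbT.
Qed.

Lemma ops_numeral (s t : seq nat) : numeral s -> t \in ops s -> numeral t.
Proof.
move=> ns; have := numeral_value_gt0 ns => s0 /(opsP _ ns)[->|[s2 ->]];
  apply: numeral_digits; lia.
Qed.

Lemma numeral_infix u s v : numeral (u ++ s ++ v) -> head 0 s != 0 -> numeral s.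
Proof. by rewrite /numeral !all_cat => /andP[/and3P[_ -> _] _] ->. Qed.

Lemma numeral_subst u s v t :
  numeral (u ++ s ++ v) -> numeral t -> numeral (u ++ t ++ v).
Proof.
rewrite /numeral !all_cat => /andP[/and3P[-> _ ->] h] /andP[-> h'] /=.
by case: u h => // _; case: t h'.
Qed.

Lemma nbrs_numeral (x y : seq nat) : numeral x -> y \in nbrs x -> numeral y.
Proof.
move=> nx /nbrsP[u [s [v [t [E s0 ts ->]]]]]; rewrite E in nx.
exact: numeral_subst nx (ops_numeral (numeral_infix nx s0) ts).
Qed.

Lemma nbrs_size (x y : seq nat) : numeral x -> y \in nbrs x -> size y <= (size x).+1.
Proof.
move=> nx /nbrsP[u [s [v [t [E s0 ts ->]]]]]; rewrite E in nx *.
have ns := numeral_infix nx s0.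
suff : size t <= (size s).+1 by rewrite !size_cat; lia.
move: ts; rewrite inE => /orP[/eqP->|]; first exact: size_double.
by case: ifP => // _; rewrite inE => /eqP->; apply: leqW; apply: size_halve.
Qed.

Lemma choix_nbrs (x y : seq nat) : numeral x -> y \in nbrs x -> choix (value x) (value y).
Proof.
move=> nx /nbrsP[u [s [v [t [E s0 ts ->]]]]].
have ns : numeral s by move: nx; rewrite E => /numeral_infix; apply.
have dx := digits_value nx.
by case/(opsP _ ns): ts => [->|[s2 ->]]; [apply: choix_double | apply: choix_halve];
  rewrite ?dx.
Qed.

Lemma choix_digits n m : 0 < n -> choix n m ->
  0 < m /\ digits m \in digits n :: nbrs (digits n).
Proof.
move=> n0; have nn := numeral_digits n0.
suff H y : y \in nbrs (digits n) ->
    0 < value y /\ digits (value y) \in digits n :: nbrs (digits n).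
  case=> [|u s v E s0|u s v E s0 s2]; first by rewrite mem_head.
    apply: H; apply/nbrsP; exists u, s, v, (digits (2 * value s)); split=> //.
    by apply/opsP; [move: nn; rewrite E => /numeral_infix; apply | left].
  apply: H; apply/nbrsP; exists u, s, v, (digits (value s %/ 2)); split=> //.
  by apply/opsP; [move: nn; rewrite E => /numeral_infix; apply | right].
move=> yn; have ny := nbrs_numeral nn yn.
by rewrite numeral_value_gt0 // digits_value // inE yn orbT.
Qed.

(** * Chains of operations *)

Lemma reaches_in0 n : reaches_in 0 n n.
Proof. by exists (fun=> n). Qed.

Lemma reaches_in_step t m n p : choix m n -> reaches_in t n p -> reaches_in t.+1 m p.
Proof.
move=> mn [c [c0 ct cS]]; exists (fun i => if i is j.+1 then c j else m).
by split=> // -[_|i it]; rewrite ?c0 //; apply: cS.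
Qed.

Lemma reaches_in_weaken t m n : reaches_in t m n -> reaches_in t.+1 m n.
Proof. exact/reaches_in_step/choix_id. Qed.

Lemma reaches_in_trans t t' m n p :
  reaches_in t m n -> reaches_in t' n p -> reaches_in (t + t') m p.
Proof.
case=> c [<- <- cS] np; elim: t c cS np => //= t IH c cS np.
apply: (reaches_in_step (cS 0 isT)).
by apply: (IH (fun i => c i.+1)) => // i it; apply: cS.
Qed.

(** * Upper bound *)

(* In an undirected graph the neighbours of one sphere lie in that sphere or
   in an adjacent one, so it suffices to discard the last two spheres. *)
Definition next_sphere (prev cur : seq (seq nat)) :=
  undup [seq y <- flatten (map nbrs cur) |
          [&& size y <= 3, y \notin prev & y \notin cur]].

Fixpoint ball (k : nat) (prev cur : seq (seq nat)) : seq (seq nat) :=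
  cur ++ if k is k'.+1 then ball k' cur (next_sphere prev cur) else [::].

(** Pruning can only lose strings, so whatever the search finds is reachable, also in front of a
    tail [v]. *)
Lemma ball_reaches k prev cur v y : all numeral cur -> all (gtn 10) v ->
  y \in ball k prev cur ->
  exists2 x, x \in cur & reaches_in k (value (x ++ v)) (value (y ++ v)).
Proof.
move=> ncur v10; elim: k prev cur ncur => [|k IH] prev cur ncur /=.
  by rewrite cats0 => yc; exists y => //; apply: reaches_in0.
rewrite mem_cat => /orP[yc|/IH[]].
(* A string found early is padded with identity operations. *)
- exists y => //; elim: (k.+1) => [|j]; [exact: reaches_in0 | exact: reaches_in_weaken].
- apply/allP => z; rewrite mem_undup mem_filter => /andP[_ /flatten_mapP[x xc]].
  exact: nbrs_numeral (allP ncur _ xc).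
move=> z; rewrite mem_undup mem_filter => /andP[_ /flatten_mapP[x xc zx]] zy.
exists x => //; apply: reaches_in_step zy; apply: choix_nbrs (nbrs_catr v zx).
exact: numeral_cat (allP ncur _ xc) v10.
Qed.

(* No operation changes whether the last digit is 0 or 5. *)
Definition root (d : nat) := if (d == 0) || (d == 5) then 5 else 1.

(** A finite search, through strings of at most three digits; its radius is the constant 12 of the
    theorem. *)
Lemma two_digits_ball r : r \in [:: 1; 5] ->
  let l := ball 12 [::] [:: [:: r]] in
  all (fun x => x \in l)
      [seq [:: a; b] | a <- iota 1 9, b <- [seq b <- iota 0 10 | root b == r]].
Proof. by rewrite !inE => /orP[] /eqP->; vm_compute. Qed.

Lemma root_reaches_two a b v : 0 < a < 10 -> b < 10 -> all (gtn 10) v ->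
  reaches_in 12 (value (root b :: v)) (value (a :: b :: v)).
Proof.
move=> a10 b10 v10.
have /ball_reaches H : [:: a; b] \in ball 12 [::] [:: [:: root b]].
  have rb : root b \in [:: 1; 5] by rewrite /root; case: ifP.
  apply: (allP (two_digits_ball rb)); apply/allpairsPdep; exists a, b.
  by rewrite mem_filter eqxx !mem_iota.
have [||x] := H v; [by rewrite /root; case: ifP | by [] |].
by rewrite inE => /eqP->.
Qed.

(** The string is built from right to left: the leading root becomes the root of the preceding digit
    followed by [b], and [b] then joins the fixed tail. *)
Lemma root_reaches s v : numeral s -> all (gtn 10) v -> 1 < size s ->
  reaches_in (12 * (size s).-1) (value (root (last 0 s) :: v)) (value (s ++ v)).
Proof.
elim/last_ind: s v => // s b IH v ns v10 s1.
have b10 : b < 10 by move: ns; rewrite /numeral all_rcons => /andP[/andP[]].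
have nss : numeral s.
  move: ns s1; rewrite /numeral all_rcons size_rcons.
  by case: (s) => //= e t /andP[/andP[_ ->] ->].
rewrite last_rcons size_rcons cat_rcons /=.
case: s nss {s1 ns} IH => // a [|c s] ns IH.
  by apply: root_reaches_two => //; move: ns; rewrite /numeral /= andbT lt0n andbC.
rewrite [size _]/= mulnS; apply: (reaches_in_trans _ (IH (b :: v) _ _ _)) => //.
  by apply: root_reaches_two => //; rewrite /root; case: ifP.
by rewrite /= v10 andbT.
Qed.

Lemma reaches_in_upper n : 10 <= n ->
  last 0 (digits n) != 0 -> last 0 (digits n) != 5 ->
  reaches_in (12 * trunc_log 10 n) 1 n.
Proof.
move=> n10 /negPf l0 /negPf l5.
have nn : numeral (digits n) by apply: numeral_digits; apply: leq_trans n10.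
have := @root_reaches (digits n) [::] nn isT.
rewrite size_digits /root l0 l5 /= cats0 value_digits; apply.
by rewrite ltnS trunc_log_gt0 n10.
Qed.

(** * Lower bound *)

(* The excess of [t] operations leading from 1 to a numeral of [k] digits is
   [t + 1 - k]; it counts an operation once if it preserves the length and twice
   if it shortens. *)
Definition excess_succ (p : nat * seq nat) : seq (nat * seq nat) :=
  [seq q <- [seq ((p.1 + size p.2).+1 - size y, y) | y <- p.2 :: nbrs p.2]
   | q.1 <= 5].

(** The excess never decreases along a chain, so a chain ending with excess at most 5 never leaves a
    set that contains the start and is closed under [excess_succ]. *)
Lemma reaches_in_excess (l : seq (nat * seq nat)) t n :
  (0, [:: 1]) \in l ->
  (forall p q, p \in l -> q \in excess_succ p -> q \in l) ->
  reaches_in t 1 n ->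
  [/\ 0 < n, size (digits n) <= t.+1
    & t.+1 - size (digits n) <= 5 -> (t.+1 - size (digits n), digits n) \in l].
Proof.
move=> l1 lS [c [c0 <- cS]]; elim: t cS => [|t IH] cS.
  by rewrite c0 digits_lt10.
have [|n0 sz exc] := IH; first by move=> i it; apply: cS; apply: ltnW.
have [m0 md] := choix_digits n0 (cS t (leqnn _)).
have szS : size (digits (c t.+1)) <= (size (digits (c t))).+1.
  move: md; rewrite inE => /orP[/eqP->//|]; exact/nbrs_size/numeral_digits.
split=> //; first exact: leq_trans szS _.
move=> le5; apply: (lS _ _ (exc _)); first lia.
rewrite mem_filter; apply/andP; split=> //; apply/mapP.
(* The size bound makes the truncated subtraction exact. *)
by exists (digits (c t.+1)) => //=; rewrite subnK.
Qed.

(** Twelve rounds from the start saturate the set, as [excess_le5_closed] confirms. *)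
Definition excess_le5 : seq (nat * seq nat) :=
  iter 12 (fun l => undup (l ++ flatten (map excess_succ l))) [:: (0, [:: 1])].

Lemma excess_le5_start : (0, [:: 1]) \in excess_le5.
Proof. by vm_compute. Qed.

Lemma excess_le5_closed p q :
  p \in excess_le5 -> q \in excess_succ p -> q \in excess_le5.
Proof.
suff : let l := excess_le5 in all (fun p => all (fun q => q \in l) (excess_succ p)) l.
  by move=> /allP H /H /allP; apply.
by vm_compute.
Qed.

Lemma excess_le5_size : all (fun p => size p.2 <= 5) excess_le5.
Proof. by vm_compute. Qed.

Lemma reaches_in_lower t n : 10 ^ 5 <= n -> reaches_in t 1 n ->
  trunc_log 10 n + 6 <= t.
Proof.
move=> nbig /(reaches_in_excess excess_le5_start excess_le5_closed)[n0 sz exc].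
(* Six digits are more than any listed string has, so the excess is at least 6. *)
have s6 : 5 < size (digits n) by rewrite size_digits ltnS; apply: trunc_log_max.
have : ~~ (t.+1 - size (digits n) <= 5).
  apply/negP => /exc /(allP excess_le5_size) /=.
  by rewrite leqNgt s6.
by move: sz {exc}; rewrite size_digits; lia.
Qed.

(** * The least count and the logarithm *)

(** Reachability provides a least count, so [xget] does not fall back on its default. *)
Lemma tauP t n : reaches_in t 1 n -> least_ops n (tau n).
Proof.
move=> tn; apply: (xgetPex 0).
have ex : exists i, `[< reaches_in i 1 n >] by exists t; apply/asboolP.
case: (ex_minnP ex) => m /asboolP mn mmin; exists m; split=> // k kn.
by apply: mmin; apply/asboolP.
Qed.

Import Order.TTheory GRing.Theory Num.Theory.
Local Open Scope ring_scope.

Lemma log10_bounds (R : realType) n : (0 < n)%N ->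
  (trunc_log 10 n)%:R <= log10 (n%:R : R) < (trunc_log 10 n).+1%:R.
Proof.
move=> n0; have ln10 : 0 < ln (10 : R) by rewrite ln_gt0 // ltr1n.
have /andP[lo hi] := trunc_log_bounds (isT : (1 < 10)%N) n0.
rewrite /log10 ler_pdivlMr // ltr_pdivrMr // !mulr_natl -!lnXn ?ltr0n //.
rewrite -!natrX ler_ln ?ltr_ln ?posrE ?ltr0n ?expn_gt0 //.
by rewrite ler_nat ltr_nat lo.
Qed.

Theorem theorem7 (R : realType) :
  exists N : nat, forall n : nat, (N <= n)%N ->
    last 0%N (digits n) != 0%N -> last 0%N (digits n) != 5%N ->
    (log10 (n%:R : R) + 5 < (tau n)%:R <= 12 * log10 (n%:R : R))%R.
Proof.
exists (10 ^ 5)%N => n nbig l0 l5.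
have n10 : (10 <= n)%N by apply: leq_trans nbig; rewrite -[leqLHS]expn1 leq_exp2l.
have up := reaches_in_upper n10 l0 l5.
have [tn tmin] := tauP up.
have /andP[lo hi] := log10_bounds R (leq_trans (isT : 0 < 10)%N n10).
apply/andP; split.
  have := reaches_in_lower nbig tn; rewrite -(ler_nat R); apply: lt_le_trans.
  (* With [k = trunc_log 10 n], write [k + 6] as [(k + 1) + 5]; the strict bound [log10 n < k + 1]
     gives strictness. *)
  by rewrite (addnS _ 5) -addSn natrD ltrD2r.
apply: (@le_trans _ _ (12 * trunc_log 10 n)%N%:R); first by rewrite ler_nat tmin.
by rewrite natrM ler_pM2l ?ltr0n.
Qed.
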